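(* For an $\mathcal{S}$-module $\Gamma$ over $K$ in $\mathbb{R}^d$ one has $$\operatorname{OS}(\Gamma)^2\subset\operatorname{OC}(\Gamma),$$ where $\operatorname{OS}(\Gamma)^2=\{R^2:R\in\operatorname{OS}(\Gamma)\}$. Thus, the factor group $\operatorname{OS}(\Gamma)/\operatorname{OC}(\Gamma)$ is an elementary Abelian $2$-group when $d$ is even. If $d$ is odd, one has $\operatorname{OS}(\Gamma)=\operatorname{OC}(\Gamma)$.
   Context: $\mathcal{S}\subset\mathbb{R}$ is a ring with unity (a subring of $\mathbb{R}$ containing $1$) that is also a finitely generated $\mathbb{Z}$-module; $K\subset\mathbb{R}$ is the field of fractions of $\mathcal{S}$. A free $\mathcal{S}$-module $\Gamma\subset\mathbb{R}^d$ of rank $d$ that spans $\mathbb{R}^d$ is the $\mathcal{S}$-span of an $\mathbb{R}$-basis of $\mathbb{R}^d$; it is a free $\mathbb{Z}$-module of finite rank. An $\mathcal{S}$-module over $K$ in $\mathbb{R}^d$ is a free $\mathcal{S}$-module $\Gamma\subset\mathbb{R}^d$ of rank $d$ that spans $\mathbb{R}^d$ and satisfies $\langle\gamma,\gamma\rangle\in K$ for all $\gamma\in\Gamma$, where $\langle\cdot,\cdot\rangle$ is the standard scalar product of $\mathbb{R}^d$. Two free $\mathbb{Z}$-modules $M,M'\subset\mathbb{R}^d$ of finite rank are commensurate, written $M\sim M'$, if $M\cap M'$ has finite index both in $M$ and in $M'$. $\operatorname{OC}(\Gamma)=\{R\in\operatorname{O}(d,\mathbb{R}):R\Gamma\sim\Gamma\}$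 and $\operatorname{OS}(\Gamma)=\{R\in\operatorname{O}(d,\mathbb{R}):\alpha R\Gamma\sim\Gamma\text{ for some real }\alpha>0\}$. These are subgroups of $\operatorname{O}(d,\mathbb{R})$, and $\operatorname{OC}(\Gamma)$ is a normal subgroup of $\operatorname{OS}(\Gamma)$. An elementary Abelian $2$-group is a (possibly trivial or infinite) direct sum of cyclic groups of order $2$. *)

(* Defs.v *)
From HB Require Import structures.
From mathcomp Require Import all_boot all_order all_algebra.
From mathcomp Require Import all_classical all_reals.

Set Implicit Arguments.
Unset Strict Implicit.
Unset Printing Implicit Defensive.

Import Order.TTheory GRing.Theory Num.Theory.

Local Open Scope classical_set_scope.
Local Open Scope ring_scope.

Definition fg_Zmodule (V : zmodType) (M : set V) : Prop :=
  exists (n : nat) (e : 'I_n -> V),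
    M = [set \sum_i e i *~ c i | c in [set: 'I_n -> int]].

Definition fraction_field (R : fieldType) (S : {pred R}) : set R :=
  [set x | exists a b, [/\ a \in S, b \in S, b != 0 & x = a / b]].

Definition scalar_product (R : pzRingType) (d : nat) (u v : 'cV[R]_d) : R :=
  \sum_i u i 0 * v i 0.

Definition free_over (R : pzRingType) (V : lmodType R) (S : {pred R})
    (n : nat) (b : 'I_n -> V) : Prop :=
  forall c : 'I_n -> R, (forall i, c i \in S) ->
    \sum_i c i *: b i = 0 -> forall i, c i = 0.

Definition span_over (R : pzRingType) (V : lmodType R) (S : {pred R})
    (n : nat) (b : 'I_n -> V) : set V :=
  [set \sum_i c i *: b i | c in [set c : 'I_n -> R | forall i, c i \in S]].

Definition free_module (R : pzRingType) (V : lmodType R) (S : {pred R})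
    (n : nat) (M : set V) : Prop :=
  exists b : 'I_n -> V, free_over S b /\ M = span_over S b.

Definition spans_space (R : pzRingType) (V : lmodType R) (M : set V) : Prop :=
  forall v, exists (n : nat) (g : 'I_n -> V) (c : 'I_n -> R),
    (forall i, M (g i)) /\ v = \sum_i c i *: g i.

Definition Smodule_over (R : realType) (S : {pred R}) (K : set R) (d : nat)
    (Gamma : set 'cV[R]_d) : Prop :=
  [/\ free_module S d Gamma, spans_space Gamma
    & forall g, Gamma g -> K (scalar_product g g)].

Definition finite_index (V : zmodType) (N M : set V) : Prop :=
  finite_set [set [set x + y | y in N] | x in M].

Definition commensurate (V : zmodType) (M N : set V) : Prop :=
  finite_index (M `&` N) M /\ finite_index (M `&` N) N.

Definition orthogonal_group (R : pzRingType) (d : nat) : set 'M[R]_d :=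
  [set A | A *m A^T = 1%:M].

Definition OC (R : realType) (d : nat) (Gamma : set 'cV[R]_d) : set 'M[R]_d :=
  [set A | orthogonal_group A /\
    commensurate [set A *m g | g in Gamma] Gamma].

Definition OS (R : realType) (d : nat) (Gamma : set 'cV[R]_d) : set 'M[R]_d :=
  [set A | orthogonal_group A /\ exists2 alpha : R, 0 < alpha &
    commensurate [set alpha *: (A *m g) | g in Gamma] Gamma].

(* The quotient H / N is the set of cosets A N, A in H, with the elementwise
   product of sets as its law. *)
Definition factor_group (R : pzRingType) (d : nat) (H N : set 'M[R]_d) :
    set (set 'M[R]_d) :=
  [set [set A *m B | B in N] | A in H].

Definition coset_mul (R : pzRingType) (d : nat) (X Y : set 'M[R]_d) :
    set 'M[R]_d :=
  [set A *m B | A in X & B in Y].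

Definition direct_sum_Z2 (I : Type) : set (I -> 'Z_2) :=
  [set f | finite_set [set i | f i != 0]].

(* (G, op) is isomorphic to a direct sum of copies of Z/2; since phi is
   injective on G and compatible with op, (G, op) is then itself a group. *)
Definition elementary_abelian_2group (T : Type) (op : T -> T -> T)
    (G : set T) : Prop :=
  (forall x y, G x -> G y -> G (op x y)) /\
  exists (I : Type) (phi : T -> I -> 'Z_2),
    set_bij G (@direct_sum_Z2 I) phi /\
    forall x y, G x -> G y -> forall i, phi (op x y) i = phi x i + phi y i.

(* Main.v *)
Require Import Defs.
From HB Require Import structures.
From mathcomp Require Import all_boot all_order all_algebra.
From mathcomp Require Import all_classical all_reals.

Local Open Scope classical_set_scope.
Local Open Scope ring_scope.
Import Order.TTheory GRing.Theory Num.Theory.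

(** Commensurability is an integrality statement up to a bounded denominator:
    for finitely generated Z-modules, [M] and [N] are commensurate exactly
    when some positive integer multiplies [M] into [N] and [N] into [M]
    ([finite_index_multiple], [multiple_finite_index]).  Hence, for an
    invertible matrix [X], the module [X Gamma] is commensurate to [Gamma] iff
    [X] and [X^-1] both map [Gamma] into itself up to an integer factor
    ([commensurate_imageP]), a condition that is visibly stable under products
    and inverses.

    An element of [S] is integral over the integers because [S] is a finitely
    generated Z-module, so a nonzero element of [S] divides a nonzero integer
    within [S] ([ring_divides_integer]).  Every element of the fraction field
    [K] thus has an integer multiple in [S], and multiplication by a nonzero
    element of [K] sends [Gamma] to a commensurate module.  Consequently, an
    orthogonal [A] such that [alpha A Gamma] is commensurate to [Gamma] lies in
    [OC Gamma] as soon as [alpha] is in [K] ([OC_of_scale_fraction]).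

    Two constraints tie [alpha] to [K].  Comparing the norms of a basis vector
    [g] and of [m alpha A g], both in [Gamma], gives [alpha ^ 2] in [K]
    ([sqr_scale_fraction]).  Taking determinants in a basis of [Gamma], where
    [m alpha A] has entries in [S] and [det A] is a sign, gives [alpha ^ d] in
    [K] ([det_scale_fraction]).  As [alpha ^ 2 A ^ 2] again sends
    [Gamma] to a commensurate module, the first constraint puts [A ^ 2] in
    [OC Gamma]; if [d] is odd, the
    two together put [alpha] itself in [K], whence [A] in [OC Gamma].

    Finally, the quotient of [OS Gamma] by [OC Gamma] has exponent two, so it
    is commutative and is a vector space over the field with two elements; a
    basis of it, provided by Zorn's lemma, identifies it with a direct sum of
    copies of Z/2 ([exponent2_elementary_abelian]). *)

(** * Groups of exponent two are direct sums of copies of Z/2 *)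

(** A linear combination over the field with two elements is the sum of a finite
    set of vectors, so that linear independence can be tested on finite
    subsets, without coefficients. *)
Definition independent {V : zmodType} (B : set V) : Prop :=
  forall A : set V, finite_set A -> A `<=` B ->
    \sum_(a \in A) a = 0 -> A = set0.

(** The elements of [A `&` B] are counted twice on the right, hence cancel:
    symmetric difference is the addition of linear combinations. *)
Lemma fsum_setY (V : zmodType) (A B : set V) :
  (forall x : V, x + x = 0) -> finite_set A -> finite_set B ->
  \sum_(a \in A `+` B) a = \sum_(a \in A) a + \sum_(a \in B) a.
Proof.
move=> V2 finA finB; rewrite (fsbigID B A) // (fsbigID A B) //.
rewrite fsbigU0; [|exact: finite_setD..|]; last by move=> x [[_ ?] []].
by rewrite -!setDE (setIC B A) addrACA V2 add0r.
Qed.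

Lemma independent_sum_inj (V : zmodType) (B A A' : set V) :
  (forall x : V, x + x = 0) -> independent B ->
  finite_set A -> finite_set A' -> A `<=` B -> A' `<=` B ->
  \sum_(a \in A) a = \sum_(a \in A') a -> A = A'.
Proof.
move=> V2 indB finA finA' AB AB' eqs.
have : A `+` A' = set0.
  apply: indB.
  - by rewrite /setY finite_setU; split; apply: finite_setD.
  - by move=> x [[/AB]|[/AB']].
  - by rewrite fsum_setY // eqs V2.
rewrite /setY setU_eq0 !setD_eq0 => -[AA' A'A]; exact/seteqP.
Qed.

(** Zorn's lemma applies because independence is a condition on finite
    subsets, hence passes to unions of chains. *)
Lemma exists_maximal_independent (V : zmodType) :
  exists B : set V, independent B /\ forall C, B `<` C -> ~ independent C.
Proof.
apply: Zorn_bigcup => F Find Ftot A finA AF sA0.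
(* A finite subset of the union of a chain lies in a member of the chain. *)
suff [A0|[X FX AX]] : A = set0 \/ exists2 X, F X & A `<=` X by [|exact: (Find X)].
have {finA} /finite_seqP[s As] := finA.
elim: s A As AF {sA0} => [|x s IHs] A ->{A} AF.
  by left; apply/seteqP; split.
right; have [X FX Xx] : (\bigcup_(X in F) X) x by apply: AF; rewrite /= inE eqxx.
have [||s0|[Y FY sY]] := IHs [set` s] => //.
- by move=> y sy; apply: AF; rewrite /= inE; apply/orP; right.
- exists X => // y; rewrite /= inE => /predU1P[->//|sy].
  by have : [set` s] y by []; rewrite s0.
- have [XY|YX] := Ftot X Y FX FY.
    by exists Y => // y; rewrite /= inE => /predU1P[->|/sY//]; apply: XY.
  by exists X => // y; rewrite /= inE => /predU1P[->//|/sY]; apply: YX.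
Qed.

(** If [v] lies outside [B], some nonempty finite subset of [v |` B] has sum
    zero; it must contain [v], and then [v] equals the sum of the others. *)
Lemma maximal_independent_span (V : zmodType) (B : set V) :
  (forall x : V, x + x = 0) ->
  independent B -> (forall C, B `<` C -> ~ independent C) ->
  forall v, exists A, [/\ finite_set A, A `<=` B & \sum_(a \in A) a = v].
Proof.
move=> V2 indB maxB v; have [Bv|nBv] := pselect (B v).
  by exists [set v]; split; [exact: finite_set1|move=> ? ->|rewrite fsbig_set1].
have : ~ independent (v |` B).
  apply: maxB; split; first by move=> x; right.
  by move=> /(_ v (or_introl erefl)).
move=> /existsNP[A] /not_implyP[finA] /not_implyP[AB] /not_implyP[sA0 An0].
have [Av|nAv] := pselect (A v); last first.
  case: An0; apply: indB => // x Ax.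
  by case: (AB x Ax) => // xv; rewrite xv in Ax.
exists (A `\ v); split; first exact: finite_setD.
  by move=> x [Ax xv]; case: (AB x Ax) => // /xv.
have eA : v + \sum_(a \in A `\ v) a = 0 by rewrite -(fsbigD1 v) //.
by apply: (addrI v); rewrite eA V2.
Qed.

Lemma natr_addb_Z2 (a b : bool) : (a (+) b)%:R = a%:R + b%:R :> 'Z_2.
Proof. by case: a; case: b; apply: val_inj. Qed.

(** The isomorphism sends [v] to the indicator function of the unique finite
    subset of the basis whose sum is [v]. *)
Lemma boolean_group_direct_sum (V : zmodType) :
  (forall x : V, x + x = 0) ->
  exists (I : Type) (phi : V -> I -> 'Z_2),
    set_bij setT (@direct_sum_Z2 I) phi /\
    forall x y i, phi (x + y) i = phi x i + phi y i.
Proof.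
move=> V2; have [B [indB maxB]] := exists_maximal_independent V.
have [A Aspec] := choice (maximal_independent_span V B V2 indB maxB).
have finA v : finite_set (A v) by case: (Aspec v).
have AB v : A v `<=` B by case: (Aspec v).
have sA v : \sum_(a \in A v) a = v by case: (Aspec v).
have AE C v : finite_set C -> C `<=` B -> \sum_(a \in C) a = v -> A v = C.
  by move=> finC CB sC; apply: (independent_sum_inj V B) => //; rewrite sA.
exists (set_type B), (fun v b => (val b \in A v)%:R); split; last first.
  move=> x y b; rewrite -natr_addb_Z2; congr (_%:R).
  have -> : A (x + y) = A x `+` A y.
    apply: AE; last by rewrite fsum_setY // !sA.
      by rewrite /setY finite_setU; split; apply: finite_setD.
    by move=> z [[/AB]|[/AB]].
  rewrite in_setU !in_setD; by case: (_ \in A x); case: (_ \in A y).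
split.
- move=> v _; rewrite /direct_sum_Z2 /=.
  apply: (@sub_finite_set _ _ (val @^-1` A v)); last first.
    by apply: finite_preimage => // b c _ _ /val_inj.
  by move=> b /=; case: (boolP (val b \in A v)) => [/set_mem|]; rewrite ?eqxx.
- move=> x y _ _ phixy; rewrite -(sA x) -(sA y).
  suff -> : A x = A y by [].
  have memE b : B b -> (b \in A x) = (b \in A y).
    move=> Bb; have := congr1 (@^~ (exist _ b (mem_set Bb) : set_type B)) phixy.
    by rewrite /=; case: (b \in A x); case: (b \in A y) => // /(congr1 val).
  apply/seteqP; split=> b Ab; apply: set_mem; move/mem_set: (Ab).
    by rewrite memE //; apply: AB Ab.
  by rewrite memE //; apply: AB Ab.
- move=> f finf.
  pose C := [set val i | i in [set i : set_type B | f i != 0]].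
  have CB : C `<=` B by move=> _ [[b Bb] _ <-]; apply: set_mem.
  have finC : finite_set C by apply: finite_image.
  exists (\sum_(a \in C) a) => //; apply/funext => i.
  rewrite (AE C) //.
  have -> : (val i \in C) = (f i != 0).
    apply/idP/idP => [/set_mem[j fj /val_inj <-//]|fi].
    by apply: mem_set; exists i.
  by case: (f i) => -[|[|//]] ?; apply: val_inj.
Qed.

(** The group law is only assumed to behave well on [G], so the subtype of
    elements of [G] is what carries the structure of an additive group. *)
Lemma exponent2_elementary_abelian (T : choiceType) (op : T -> T -> T)
    (G : set T) (e : T) :
  (forall x y, G x -> G y -> G (op x y)) -> G e ->
  (forall x y z, G x -> G y -> G z -> op x (op y z) = op (op x y) z) ->
  (forall x, G x -> op e x = x) -> (forall x, G x -> op x x = e) ->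
  elementary_abelian_2group op G.
Proof.
move=> opG Ge opA op1 opxx; split=> //.
have ope x : G x -> op x e = x by move=> Gx; rewrite -(opxx x) // opA // opxx // op1.
have opC x y : G x -> G y -> op x y = op y x.
  (* (xy)(xy) = 1 gives xy = (xy)^-1 = y^-1 x^-1 = yx *)
  move=> Gx Gy; have Gxy := opG x y Gx Gy; have Gyx := opG y x Gy Gx.
  have xyyx : op (op x y) (op y x) = e.
    by rewrite -opA // (opA y y x) // opxx // op1 // opxx.
  by rewrite -(op1 (op y x)) // -(opxx (op x y)) // -opA // xyyx ope.
pose U : choiceType := {x : T | x \in G}.
pose add (x y : U) : U :=
  exist _ (op (val x) (val y))
    (mem_set (opG _ _ (set_mem (valP x)) (set_mem (valP y)))).
have GU (x : U) : G (val x) by exact: set_mem (valP x).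
pose zero : U := exist _ e (mem_set Ge).
have addA : associative add by move=> x y z; apply: val_inj; apply: opA.
have addC : commutative add by move=> x y; apply: val_inj; apply: opC.
have add0 : left_id zero add by move=> x; apply: val_inj; apply: op1.
have addN : left_inverse zero id add by move=> x; apply: val_inj; apply: opxx.
pose V := HB.pack_for zmodType U (GRing.isZmodule.Build U addA addC add0 addN).
have [I [phi [[phiD phi_inj phi_surj] phiM]]] :=
  boolean_group_direct_sum V (fun x : V => addN x).
have insubK x : G x -> val (insubd zero x) = x.
  by move=> Gx; apply: insubdK; apply: mem_set.
exists I, (fun x => phi (insubd zero x)); split; first split.
- by move=> x _; apply: phiD.
- move=> x y /set_mem Gx /set_mem Gy /(phi_inj _ _ (in_setT _) (in_setT _)).
  by move=> /(congr1 val); rewrite !insubK.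
- move=> f /phi_surj[v _ <-]; exists (val v) => //.
  by congr phi; apply: val_inj; rewrite insubK.
- move=> x y Gx Gy i; rewrite -phiM; congr (phi _ i).
  by apply: val_inj; rewrite /= !insubK //; exact (opG _ _ Gx Gy).
Qed.
(** * Commensurability and bounded denominators *)

Definition zsubmod {V : zmodType} (M : set V) : Prop :=
  M 0 /\ forall x y, M x -> M y -> M (x - y).

Lemma zsubmodN {V : zmodType} (M : set V) x : zsubmod M -> M x -> M (- x).
Proof. by move=> [M0 MB] Mx; rewrite -sub0r; apply: MB. Qed.

Lemma zsubmodD {V : zmodType} (M : set V) x y :
  zsubmod M -> M x -> M y -> M (x + y).
Proof.
by move=> zM Mx My; rewrite -(opprK y); apply: (proj2 zM) => //; apply: zsubmodN.
Qed.

Lemma zsubmodMn {V : zmodType} (M : set V) x n : zsubmod M -> M x -> M (x *+ n).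
Proof.
move=> zM Mx; elim: n => [|n IHn]; first by rewrite mulr0n; apply: (proj1 zM).
by rewrite mulrS; apply: zsubmodD.
Qed.

Lemma zsubmodI {V : zmodType} (M N : set V) :
  zsubmod M -> zsubmod N -> zsubmod (M `&` N).
Proof.
move=> [M0 MB] [N0 NB]; split=> // x y [Mx Nx] [My Ny].
by split; [apply: MB|apply: NB].
Qed.

Lemma fg_Zmodule_zsubmod {V : zmodType} (M : set V) : fg_Zmodule M -> zsubmod M.
Proof.
move=> [n [e ->]]; split.
  by exists (fun=> 0) => //; rewrite big1 // => i _; rewrite mulr0z.
move=> _ _ [a _ <-] [b _ <-]; exists (fun i => a i - b i) => //.
by rewrite -sumrB; apply: eq_bigr => i _; rewrite mulrzBr.
Qed.

Lemma fg_Zmodule_image {V W : zmodType} (f : {additive V -> W}) (M : set V) :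
  fg_Zmodule M -> fg_Zmodule (f @` M).
Proof.
move=> [n [e ->]]; exists n, (f \o e); rewrite image_comp.
apply: eq_imagel => c _ /=; rewrite raddf_sum.
by apply: eq_bigr => i _; rewrite raddfMz.
Qed.

Lemma coset_eq {V : zmodType} (N : set V) (x y : V) : zsubmod N ->
  [set x + z | z in N] = [set y + z | z in N] <-> N (x - y).
Proof.
move=> zN; split=> [eN|Nxy].
  have [z Nz xz] : [set y + z | z in N] x.
    by rewrite -eN; exists 0; [apply: (proj1 zN)|rewrite addr0].
  by rewrite -xz addrC addKr.
apply/seteqP; split=> _ [z Nz <-].
  by exists (x - y + z); [apply: zsubmodD|rewrite addrA [y + _]addrC subrK].
exists (z - (x - y)); first exact: (proj2 zN).
by rewrite opprB addrCA [x + _]addrC subrK addrC.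
Qed.

(** If the cosets are listed by [s], the pigeonhole principle makes two of the
    multiples of [x] up to [size s] congruent modulo [N], so [N] contains
    [x *+ k] for some positive [k] at most [size s]; the factorial of [size s]
    is a multiple of all such [k], whatever [x] is. *)
Lemma finite_index_multiple {V : zmodType} (M N : set V) :
  zsubmod M -> zsubmod N -> finite_index N M ->
  exists2 m : nat, (0 < m)%N & forall x, M x -> N (x *+ m).
Proof.
move=> zM zN /finite_seqP[s es]; exists (size s)`!; first exact: fact_gt0.
move=> x Mx; pose co k := [set x *+ k + z | z in N].
pose cosets := [seq co k | k <- iota 0 (size s).+1].
have co_s k : co k \in s.
  suff : [set` s] (co k) by [].
  by rewrite -es; exists (x *+ k) => //; apply: zsubmodMn.
have /(uniqPn set0)[i [j [ltij]]] : ~~ uniq cosets.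
  apply/negP => uco; have := @uniq_leq_size _ cosets s uco.
  rewrite size_map size_iota ltnn => les; suff: false by []; apply: les.
  by move=> _ /mapP[k _ ->].
rewrite size_map size_iota => ltjs.
have lti := ltn_trans ltij ltjs.
rewrite !(nth_map 0%N) ?size_iota // !nth_iota // !add0n.
move=> /esym/(coset_eq _ _ _ zN); rewrite -mulrnBr ?(ltnW ltij) // => Nij.
have /dvdnP[q ->] : (j - i %| (size s)`!)%N.
  by rewrite dvdn_fact // subn_gt0 ltij /= (leq_trans (leq_subr _ _)).
by rewrite mulnC mulrnA; apply: zsubmodMn.
Qed.

(** Modulo [N] the coefficients of the generators of [M] only matter modulo [m],
    which leaves finitely many cosets. *)
Lemma multiple_finite_index {V : zmodType} (M N : set V) (m : nat) :
  fg_Zmodule M -> zsubmod N -> (0 < m)%N -> (forall x, M x -> N (x *+ m)) ->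
  finite_index N M.
Proof.
move=> [n [e eM]] zN m_gt0 mMN.
apply: (@sub_finite_set _ _ [set [set \sum_i e i *+ r i + z | z in N] |
  r in [set: {ffun 'I_n -> 'I_m}]]); last first.
  by apply: finite_image; apply: finite_finset.
have mz_gt0 : (0 < m%:Z) by [].
move=> _ [x Mx <-]; move: Mx; rewrite eM => -[c _ <-].
have ltm i : (`|(c i %% m)%Z| < m)%N.
  by rewrite -ltz_nat gez0_abs ?modz_ge0 ?ltz_pmod // lt0r_neq0.
exists [ffun i => Ordinal (ltm i)] => //; apply/coset_eq => //.
rewrite -sumrB.
have -> : \sum_i (e i *+ [ffun i => Ordinal (ltm i)] i - e i *~ c i)
   = - ((\sum_i e i *~ (c i %/ m)%Z) *+ m).
  rewrite -sumrMnl -sumrN; apply: eq_bigr => i _; rewrite ffunE /=.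
  rewrite {2}(divz_eq (c i) m) mulrzDr pmulrn gez0_abs ?modz_ge0 ?lt0r_neq0 //.
  by rewrite opprD addrCA subrr addr0 mulrzA pmulrn.
apply: zsubmodN => //; apply: mMN; rewrite eM.
by exists (fun i => (c i %/ m)%Z).
Qed.

(** * Integrality in a finitely generated ring *)

Section FinitelyGeneratedRing.
Variables (R : realType) (S : subringClosed R).
Hypothesis S_fg : fg_Zmodule [set x : R | x \in S].

(** Multiplication by [b] acts on the generators [e] of [S] through an integer
    matrix, of which [b] is an eigenvalue with eigenvector [e]; the
    characteristic polynomial of that matrix annihilates [b].  The vector [e]
    is nonzero since [1] is a combination of its entries. *)
Lemma fg_ring_integral (b : R) : b \in S ->
  exists2 p : {poly int}, p != 0 & root (map_poly intr p) b.
Proof.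
move=> Sb; have [n [e eS]] := S_fg.
have Se i : e i \in S.
  suff : [set x | x \in S] (e i) by [].
  rewrite eS; exists (fun j => (j == i)%:Z) => //.
  by rewrite (bigD1 i) //= eqxx mulr1z big1 ?addr0 // => j /negPf->; rewrite mulr0z.
have /choice[M eM] i : exists c : 'I_n -> int, \sum_j e j *~ c j = b * e i.
  have : [set x | x \in S] (b * e i) by rewrite /= rpredM.
  by rewrite eS => -[c _ ce]; exists c.
pose A : 'M[int]_n := \matrix_(i, j) M j i.
exists (char_poly A); first by rewrite monic_neq0 ?char_poly_monic.
rewrite map_char_poly -eigenvalue_root_char; apply/eigenvalueP.
exists (\row_i e i).
  apply/rowP => i; rewrite !mxE -eM; apply: eq_bigr => j _.
  by rewrite !mxE mulrzr.
apply/eqP => /rowP e0.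
have : [set x | x \in S] 1 by rewrite /= rpred1.
rewrite eS => -[c _]; rewrite big1 => [/eqP|i _]; first by rewrite eq_sym oner_eq0.
by have := e0 i; rewrite !mxE => ->; rewrite mul0rz.
Qed.

(** Dividing an integer polynomial that vanishes at [b] by a power of ['X] gives
    one with a nonzero constant term, and that constant term is a multiple of
    [b] in [S]. *)
Lemma ring_divides_integer (b : R) : b \in S -> b != 0 ->
  exists t (n : nat), [/\ t \in S, (0 < n)%N & b * t = n%:R].
Proof.
move=> Sb b0; have [p] := fg_ring_integral b Sb.
have [k] := ubnP (size p); elim: k p => // k IHk p ltpk p0 pb.
have [q eq] : exists q, p - (p.[0])%:P = q * 'X.
  have /factor_theorem[q] : root (p - (p.[0])%:P) 0.
    by rewrite /root !hornerE subrr.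
  by rewrite subr0; exists q.
have Sq : (map_poly intr q).[b] \in S.
  by apply: rpred_horner => //; apply/polyOverP => i; rewrite coef_map rpred_int.
have {eq} ep : p = q * 'X + (p.[0])%:P by rewrite -eq subrK.
have [p00|p00] := eqVneq p.[0] 0.
  rewrite p00 addr0 in ep.
  have q0 : q != 0 by apply: contraNneq p0 => q0; rewrite ep q0 mul0r.
  apply: (IHk q) => //; first by rewrite ep size_mulX // in ltpk.
  by move: pb; rewrite ep rmorphM /= map_polyX rootM rootX (negPf b0) orbF.
have : (map_poly intr q).[b] * b + (p.[0])%:~R = 0.
  move/rootP: pb; rewrite {1}ep rmorphD rmorphM /= map_polyX map_polyC /=.
  by rewrite !hornerE.
move/eqP; rewrite addr_eq0 mulrC => /eqP bq.
(* The sign turns the constant term into a natural number. *)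
exists ((map_poly intr q).[b] * (- Num.sg p.[0])%:~R), `|p.[0]|%N; split.
- by rewrite rpredM // rpred_int.
- by rewrite absz_gt0.
- by rewrite mulrA bq rmorphN mulrNN -rmorphM /= mulrC -normrEsg -abszE.
Qed.

Lemma fraction_field_integer_multiple (x : R) : fraction_field S x ->
  exists2 n : nat, (0 < n)%N & x *+ n \in S.
Proof.
move=> [a [b [Sa Sb b0 ->]]].
have [t [n [St n_gt0 bt]]] := ring_divides_integer b Sb b0.
by exists n => //; rewrite -mulr_natr -bt mulrA divfK // rpredM.
Qed.

End FinitelyGeneratedRing.

(** * Groups of coincidence and similarity isometries *)

(** The matrices [A] such that [A Gamma] is contained in [Gamma] up to an
    integer factor; when [Gamma] is a lattice these are the rational matrices
    in a basis of [Gamma]. *)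
Definition quasi_preserves {R : realType} {d : nat} (Gamma : set 'cV[R]_d)
    (A : 'M[R]_d) : Prop :=
  exists2 m : nat, (0 < m)%N & forall g, Gamma g -> Gamma ((A *m g) *+ m).

Lemma mulmxMn (R : pzRingType) (m n p : nat) (A : 'M[R]_(m, n))
    (B : 'M[R]_(n, p)) k : A *m (B *+ k) = (A *m B) *+ k.
Proof. exact: (raddfMn (mulmx A)). Qed.

Section QuasiPreserves.
Variables (R : realType) (d : nat) (Gamma : set 'cV[R]_d).

Lemma quasi_preserves1 : quasi_preserves Gamma 1%:M.
Proof. by exists 1%N => // g Gg; rewrite mul1mx. Qed.

Lemma quasi_preservesM (A B : 'M[R]_d) :
  quasi_preserves Gamma A -> quasi_preserves Gamma B ->
  quasi_preserves Gamma (A *m B).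
Proof.
move=> [m m_gt0 mA] [n n_gt0 nB]; exists (n * m)%N; first by rewrite muln_gt0 n_gt0.
by move=> g /nB/mA; rewrite mulmxMn mulmxA mulrnA.
Qed.

Lemma commensurate_imageP (A B : 'M[R]_d) :
  fg_Zmodule Gamma -> A *m B = 1%:M ->
  commensurate [set A *m g | g in Gamma] Gamma <->
  quasi_preserves Gamma A /\ quasi_preserves Gamma B.
Proof.
move=> fgG AB; have BA := mulmx1C AB.
have fgAG : fg_Zmodule [set A *m g | g in Gamma].
  exact: (fg_Zmodule_image (mulmx A : {additive 'cV[R]_d -> 'cV[R]_d})).
have zG := fg_Zmodule_zsubmod _ fgG; have zAG := fg_Zmodule_zsubmod _ fgAG.
have zI := zsubmodI _ _ zAG zG.
split=> [[/(finite_index_multiple _ _ zAG zI)[m m_gt0 mA]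
          /(finite_index_multiple _ _ zG zI)[n n_gt0 nB]]|
        [[m m_gt0 mA] [n n_gt0 nB]]].
  split; [exists m => // g Gg|exists n => // g Gg].
    by have [|] := mA (A *m g) => //; exists g.
  by have [[h Gh hg] _] := nB g Gg; rewrite -mulmxMn -hg mulmxA BA mul1mx.
split.
  apply: (multiple_finite_index _ _ m) => // _ [g Gg <-]; split; last exact: mA.
  by exists (g *+ m); [apply: zsubmodMn|rewrite mulmxMn].
apply: (multiple_finite_index _ _ n) => // g Gg; split; last exact: zsubmodMn.
by exists ((B *m g) *+ n); [apply: nB|rewrite mulmxMn mulmxA AB mul1mx].
Qed.

Lemma OCP (A : 'M[R]_d) : fg_Zmodule Gamma ->
  OC Gamma A <-> [/\ A *m A^T = 1%:M, quasi_preserves Gamma A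
                   & quasi_preserves Gamma A^T].
Proof.
move=> fgG; split=> [[orthA]|[orthA qA qAT]].
  by move/(commensurate_imageP _ _ fgG orthA) => [].
by split=> //; apply/(commensurate_imageP _ _ fgG orthA).
Qed.

Lemma OSP (A : 'M[R]_d) : fg_Zmodule Gamma ->
  OS Gamma A <-> A *m A^T = 1%:M /\ exists2 alpha : R, 0 < alpha &
    quasi_preserves Gamma (alpha *: A) /\
    quasi_preserves Gamma (alpha^-1 *: A^T).
Proof.
move=> fgG.
have image_scale (a : R) : [set a *: (A *m g) | g in Gamma] =
    [set (a *: A) *m g | g in Gamma].
  by apply: eq_imagel => g _; rewrite scalemxAl.
have inv (a : R) : 0 < a -> A *m A^T = 1%:M ->
    (a *: A) *m (a^-1 *: A^T) = 1%:M.
  move=> a_gt0 orthA; rewrite -scalemxAl -scalemxAr scalerA orthA.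
  by rewrite divff ?scale1r // lt0r_neq0.
split=> [] [orthA [a a_gt0 aA]]; split=> //; exists a => //.
  by apply/(commensurate_imageP _ _ fgG (inv a a_gt0 orthA)); rewrite -image_scale.
rewrite image_scale; exact/(commensurate_imageP _ _ fgG (inv a a_gt0 orthA)).
Qed.

Hypothesis fgG : fg_Zmodule Gamma.

Lemma OC1 : OC Gamma 1%:M.
Proof.
by apply/OCP => //; rewrite trmx1 mulmx1; split=> //; apply: quasi_preserves1.
Qed.

Lemma OCM (A B : 'M[R]_d) : OC Gamma A -> OC Gamma B -> OC Gamma (A *m B).
Proof.
move=> /OCP[]// oA qA qAT /OCP[]// oB qB qBT; apply/OCP => //; split.
- by rewrite trmx_mul mulmxA -(mulmxA A) oB mulmx1.
- exact: quasi_preservesM.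
- by rewrite trmx_mul; apply: quasi_preservesM.
Qed.

Lemma OCV (A : 'M[R]_d) : OC Gamma A -> OC Gamma A^T.
Proof.
move=> /OCP[]// oA qA qAT; apply/OCP => //; rewrite trmxK; split=> //.
exact: mulmx1C.
Qed.

Lemma OC_OS (A : 'M[R]_d) : OC Gamma A -> OS Gamma A.
Proof.
move=> /OCP[]// oA qA qAT; apply/OSP => //; split=> //; exists 1 => //.
by rewrite invr1 !scale1r.
Qed.

Lemma OSM (A B : 'M[R]_d) : OS Gamma A -> OS Gamma B -> OS Gamma (A *m B).
Proof.
move=> /OSP[]// oA [a a_gt0 [qA qAT]] /OSP[]// oB [b b_gt0 [qB qBT]].
apply/OSP => //; split; first by rewrite trmx_mul mulmxA -(mulmxA A) oB mulmx1.
exists (a * b); first exact: mulr_gt0.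
rewrite trmx_mul invfM; split.
  by rewrite -scalerA scalemxAr scalemxAl; apply: quasi_preservesM.
by rewrite mulrC -scalerA scalemxAr scalemxAl; apply: quasi_preservesM.
Qed.

(** Conjugating by [A] is the same as conjugating by the similarity [a A], which
    is invertible up to integer factors on [Gamma]. *)
Lemma OC_normal (A N : 'M[R]_d) : OS Gamma A -> OC Gamma N ->
  OC Gamma (A^T *m N *m A).
Proof.
move=> /OSP[]// oA [a a_gt0 [qA qAT]] /OCP[]// oN qN qNT.
have conj (X : 'M[R]_d) : A^T *m X *m A = (a^-1 *: A^T) *m X *m (a *: A).
  by rewrite -!scalemxAl -scalemxAr scalerA mulVf ?scale1r // lt0r_neq0.
apply/OCP => //; rewrite !trmx_mul trmxK mulmxA; split.
- rewrite !mulmxA -(mulmxA _ A) oA mulmx1 -(mulmxA _ N) oN mulmx1.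
  exact: mulmx1C.
- by rewrite conj; do 2!apply: quasi_preservesM => //.
- by rewrite conj; do 2!apply: quasi_preservesM => //.
Qed.

Lemma coset_mulE (A B : 'M[R]_d) : OS Gamma A -> OS Gamma B ->
  coset_mul [set A *m N | N in OC Gamma] [set B *m N | N in OC Gamma] =
  [set A *m B *m N | N in OC Gamma].
Proof.
move=> OSA OSB; apply/seteqP; split.
  move=> _ [_ [M OCM' <-] [_ [N OCN <-] <-]].
  exists (B^T *m M *m B *m N); first by apply: OCM => //; apply: OC_normal.
  have [oB _] := proj1 (OSP B fgG) OSB.
  by rewrite !mulmxA -(mulmxA A) oB mulmx1.
move=> _ [N OCN <-]; exists (A *m 1%:M); first by exists 1%:M => //; apply: OC1.
by exists (B *m N); [exists N|rewrite mulmx1 mulmxA].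
Qed.

Lemma coset_OC (N : 'M[R]_d) : OC Gamma N ->
  [set N *m M | M in OC Gamma] = [set 1%:M *m M | M in OC Gamma].
Proof.
move=> OCN; apply/seteqP; split=> _ [M OCM' <-].
  by exists (N *m M); [apply: OCM|rewrite mul1mx].
exists (N^T *m M); first by apply: OCM => //; apply: OCV.
by have [oN _ _] := proj1 (OCP N fgG) OCN; rewrite mulmxA oN.
Qed.

Lemma factor_group_elementary :
  [set A *m A | A in OS Gamma] `<=` OC Gamma ->
  elementary_abelian_2group (@coset_mul R d)
    (factor_group (OS Gamma) (OC Gamma)).
Proof.
move=> OS2; have OS1 := OC_OS _ OC1.
apply: (exponent2_elementary_abelian _ _ _ [set 1%:M *m N | N in OC Gamma]).
- move=> _ _ [A OSA <-] [B OSB <-]; rewrite coset_mulE //.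
  by exists (A *m B) => //; apply: OSM.
- by exists 1%:M.
- move=> _ _ _ [A OSA <-] [B OSB <-] [C OSC <-].
  by rewrite !coset_mulE ?mulmxA //; apply: OSM.
- by move=> _ [A OSA <-]; rewrite coset_mulE // mul1mx.
- move=> _ [A OSA <-]; rewrite coset_mulE // coset_OC //.
  by apply: OS2; exists A.
Qed.

End QuasiPreserves.

(** * The scaling factors and the fraction field *)

Section FractionField.
Variables (R : realType) (S : subringClosed R).
Local Notation K := (fraction_field S).

Lemma ring_fraction (x : R) : x \in S -> K x.
Proof. by move=> Sx; exists x, 1; rewrite rpred1 oner_neq0 divr1. Qed.

Lemma fractionM (x y : R) : K x -> K y -> K (x * y).
Proof.
move=> [a [b [Sa Sb b0 ->]]] [c [e [Sc Se e0 ->]]]; exists (a * c), (b * e).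
by rewrite !rpredM // mulf_neq0 // mulf_div.
Qed.

Lemma fractionV (x : R) : K x -> K x^-1.
Proof.
move=> [a [b [Sa Sb b0 ->]]]; rewrite invf_div.
have [->|a0] := eqVneq a 0; last by exists b, a.
by rewrite invr0 mulr0; apply: ring_fraction; apply: rpred0.
Qed.

Lemma fractionX (x : R) n : K x -> K (x ^+ n).
Proof.
move=> Kx; elim: n => [|n IHn]; last by rewrite exprS; apply: fractionM.
by apply: ring_fraction; rewrite expr0 rpred1.
Qed.

End FractionField.

Section ModuleOverK.
Variables (R : realType) (S : subringClosed R).
Hypothesis S_fg : fg_Zmodule [set x : R | x \in S].
Local Notation K := (fraction_field S).
Variables (d : nat) (Gamma : set 'cV[R]_d).
Hypothesis Gamma_over_K : Smodule_over S K Gamma.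

(** If [e] generates [S] over the integers and [b] is a basis of [Gamma] over
    [S], then the products [e i *: b j] generate [Gamma] over the integers. *)
Lemma module_fg : fg_Zmodule Gamma.
Proof.
have [[b [_ ->]] _ _] := Gamma_over_K; have [n [e eS]] := S_fg.
exists #|{: 'I_d * 'I_n}|.
exists (fun k => e (enum_val k).2 *: b (enum_val k).1).
have sumE (c : 'I_d * 'I_n -> int) :
    \sum_(k < #|{: 'I_d * 'I_n}|)
      (e (enum_val k).2 *: b (enum_val k).1) *~ c (enum_val k) =
    \sum_j (\sum_i e i *~ c (j, i)) *: b j.
  rewrite -(big_enum_val (A := {: 'I_d * 'I_n}) (fun p => (e p.2 *: b p.1) *~ c p)).
  transitivity (\sum_(p : 'I_d * 'I_n) (e p.2 *: b p.1) *~ c (p.1, p.2)).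
    by apply: eq_big => [p|[]]; rewrite ?inE.
  rewrite -(pair_bigA _ (fun j i => (e i *: b j) *~ c (j, i))) /=.
  apply: eq_bigr => j _; rewrite scaler_suml; apply: eq_bigr => i _.
  by rewrite scalerMzl.
apply/seteqP; split.
  move=> _ [c Sc <-].
  have /choice[k kc] j : exists k : 'I_n -> int, \sum_i e i *~ k i = c j.
    have : [set x | x \in S] (c j) by apply: Sc.
    by rewrite eS => -[k _]; exists k.
  exists (fun p => k (enum_val p).1 (enum_val p).2) => //.
  rewrite (sumE (fun p => k p.1 p.2)).
  by apply: eq_bigr => j _; rewrite kc.
move=> _ [c _ <-]; pose c' p := c (enum_rank p).
exists (fun j => \sum_i e i *~ c' (j, i)).
  move=> j /=; suff : [set x | x \in S] (\sum_i e i *~ c' (j, i)) by [].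
  by rewrite eS; exists (fun i => c' (j, i)).
by rewrite -sumE; apply: eq_bigr => k _; rewrite /c' enum_valK.
Qed.

(** Some integer multiple of [x] lies in [S], and [Gamma] is stable under
    [S]. *)
Lemma quasi_preserves_scalar (x : R) (A : 'M[R]_d) :
  K x -> quasi_preserves Gamma A -> quasi_preserves Gamma (x *: A).
Proof.
move=> /(fraction_field_integer_multiple _ _ S_fg)[n n_gt0 Snx] [m m_gt0 mA].
exists (m * n)%N; first by rewrite muln_gt0 m_gt0.
move=> g /mA; have [[b [_ ->]] _ _] := Gamma_over_K => -[c Sc cE].
exists (fun i => x *+ n * c i) => [i|]; first by rewrite rpredM // Sc.
rewrite -scalemxAl mulrnA scalerMnr -cE scalerMnl scaler_sumr.
by apply: eq_bigr => i _; rewrite scalerA.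
Qed.

(** Since [a] and its inverse are in [K], the factors [a] of [a A] and
    [a^-1] of its inverse can be cancelled. *)
Lemma OC_of_scale_fraction (A : 'M[R]_d) (a : R) : 0 < a -> K a ->
  A *m A^T = 1%:M -> quasi_preserves Gamma (a *: A) ->
  quasi_preserves Gamma (a^-1 *: A^T) -> OC Gamma A.
Proof.
move=> a_gt0 Ka oA qA qAT; have a0 := lt0r_neq0 a_gt0.
apply/OCP; [exact: module_fg|split=> //].
  rewrite -[A]scale1r -(mulVf a0) -scalerA.
  by apply: quasi_preserves_scalar => //; apply: fractionV.
rewrite -[A^T]scale1r -(divff a0) -scalerA.
exact: quasi_preserves_scalar.
Qed.

(** For a nonzero [g] in [Gamma], the vector [m a A g] is in [Gamma] for some
    positive integer [m]; its norm [m ^ 2 a ^ 2 <g, g>] and the norm [<g, g>]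
    are both in [K].  Dimension zero is excluded, as then no such [g] exists
    and [a] is arbitrary. *)
Lemma sqr_scale_fraction (A : 'M[R]_d) (a : R) : (0 < d)%N ->
  A *m A^T = 1%:M -> quasi_preserves Gamma (a *: A) -> K (a ^+ 2).
Proof.
move=> d_gt0 oA [m m_gt0 mA]; have [[b [bfree GE]] _ GK] := Gamma_over_K.
have [i0 _] : exists i0 : 'I_d, true by exists (Ordinal d_gt0).
pose g := b i0.
have gE : \sum_i (i == i0)%:R *: b i = g.
  rewrite (bigD1 i0) //= eqxx scale1r big1 ?addr0 // => i /negPf->.
  by rewrite scale0r.
have Sdelta (i : 'I_d) : (i == i0)%:R \in S by apply: rpred_nat.
have Gg : Gamma g by rewrite GE; exists (fun i => (i == i0)%:R).
have g0 : g != 0.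
  apply/eqP => g0; rewrite g0 in gE.
  by have /eqP := bfree _ Sdelta gE i0; rewrite eqxx oner_eq0.
have spE (u : 'cV[R]_d) : scalar_product u u = (u^T *m u) 0 0.
  by rewrite mxE; apply: eq_bigr => i _; rewrite mxE.
have gg0 : scalar_product g g != 0.
  apply: contraNneq g0 => /eqP; rewrite psumr_eq0 => [/allP gi|i _]; last first.
    by rewrite -expr2 sqr_ge0.
  apply/eqP/colP => i; rewrite mxE; apply/eqP; rewrite -sqrf_eq0 expr2.
  exact: gi (mem_index_enum i).
have := GK _ (mA g Gg).
have -> : (a *: A *m g) *+ m = (a * m%:R) *: (A *m g).
  by rewrite -scalemxAl -scaler_nat scalerA mulrC.
have trZ k (X : 'cV[R]_d) : (k *: X)^T = k *: X^T.
  by apply/matrixP => i j; rewrite !mxE.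
rewrite spE trZ -scalemxAl -scalemxAr scalerA trmx_mul mulmxA.
rewrite -(mulmxA g^T) (mulmx1C oA) mulmx1 mxE -spE -expr2 exprMn => Kprod.
have m0 : (m%:R : R) ^+ 2 != 0 by rewrite expf_neq0 // pnatr_eq0 -lt0n.
have -> : a ^+ 2 = a ^+ 2 * m%:R ^+ 2 * scalar_product g g *
    (m%:R ^+ 2 * scalar_product g g)^-1.
  by rewrite -(mulrA (a ^+ 2)) mulfK // mulf_neq0.
apply: fractionM => //; apply: fractionV; apply: fractionM; last exact: GK.
by apply: fractionX; apply: ring_fraction; apply: rpred_nat.
Qed.

(** Let [B] have a basis of [Gamma] as columns.  For some positive integer [m],
    the relation [m a A B = B C] holds with [C] a matrix over [S], and taking
    determinants yields [(m a) ^ d det A = det C] with [det A] a sign. *)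
Lemma det_scale_fraction (A : 'M[R]_d) (a : R) :
  A *m A^T = 1%:M -> quasi_preserves Gamma (a *: A) -> K (a ^+ d).
Proof.
move=> oA [m m_gt0 mA]; have [[b [_ GE]] Gspan _] := Gamma_over_K.
pose B : 'M[R]_d := \matrix_(i, j) b j i 0.
have GB g : Gamma g <-> exists2 c : 'cV[R]_d, (forall i, c i 0 \in S) & g = B *m c.
  rewrite GE; split=> [[c Sc <-]|[c Sc ->]].
    exists (\col_i c i) => [i|]; first by rewrite mxE Sc.
    apply/colP => i; rewrite mxE summxE; apply: eq_bigr => j _.
    by rewrite !mxE mulrC.
  exists (fun i => c i 0) => //; apply/colP => i; rewrite mxE summxE.
  by apply: eq_bigr => j _; rewrite !mxE mulrC.
have GbB j : Gamma (col j B).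
  apply/GB; exists (delta_mx j 0) => [i|]; last by rewrite -colE.
  by rewrite mxE rpred_nat.
(* The columns of [B] span the whole space, so [B] has a right inverse. *)
have Bunit : B \in unitmx.
  have /choice[C CE] j : exists c : 'cV[R]_d, B *m c = delta_mx j 0.
    have [n [g [c [Gg ->]]]] := Gspan (delta_mx j 0).
    have /choice[h hE] i : exists h, g i = B *m h.
      by have [h _ ->] := proj1 (GB _) (Gg i); exists h.
    exists (\sum_i c i *: h i); rewrite mulmx_sumr.
    by apply: eq_bigr => i _; rewrite -scalemxAr hE.
  have BC : B *m (\matrix_(i, j) C j i 0) = 1%:M.
    apply/matrixP => i j; have /colP/(_ i) := CE j; rewrite !mxE andbT => <-.
    by apply: eq_bigr => k _; rewrite !mxE.
  by have [] := mulmx1_unit BC.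
have /choice[c cE] j : exists c : 'cV[R]_d, (forall i, c i 0 \in S) /\
    (a *: A *m col j B) *+ m = B *m c.
  by have [c Sc ->] := proj1 (GB _) (mA _ (GbB j)); exists c.
pose C : 'M[R]_d := \matrix_(i, j) c j i 0.
have ABC : ((a * m%:R) *: A) *m B = B *m C.
  apply/matrixP => i j; have /colP/(_ i) := proj2 (cE j).
  rewrite -scaler_nat scalemxAl scalerA mulrC => eij.
  transitivity ((B *m c j) i 0); last by rewrite !mxE; apply: eq_bigr => k _; rewrite !mxE.
  by rewrite -eij !mxE; apply: eq_bigr => k _; rewrite !mxE.
have SC : \det C \in S.
  apply: rpred_sum => s _; rewrite rpredM ?rpred_sign // rpred_prod // => i _.
  by rewrite mxE; apply: (proj1 (cE _)).
have detA : \det A = 1 \/ \det A = -1.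
  have := congr1 (fun X => \det X) oA; rewrite det_mulmx det_tr det1 -expr2.
  by move/eqP; rewrite sqrf_eq1 => /orP[]/eqP->; [left|right].
have m0 : (m%:R : R) ^+ d != 0 by rewrite expf_neq0 // pnatr_eq0 -lt0n.
have : (a * m%:R) ^+ d * \det A = \det C.
  have := congr1 (fun X => \det X) ABC; rewrite !det_mulmx detZ [RHS]mulrC.
  by apply: mulIf; rewrite -unitfE -unitmxE.
rewrite exprMn => detE.
have -> : a ^+ d = \det C * \det A * (m%:R ^+ d)^-1.
  rewrite -detE -!mulrA [\det A * (\det A * _)]mulrA.
  have -> : \det A * \det A = 1 by case: detA => ->; rewrite ?mulrNN mulr1.
  by rewrite mul1r divff ?mulr1.
apply: fractionM.
  by apply: ring_fraction; case: detA => ->; rewrite ?mulr1 ?mulrN1 ?rpredN.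
by apply: fractionV; apply: fractionX; apply: ring_fraction; apply: rpred_nat.
Qed.

Lemma OS_sqr : [set A *m A | A in OS Gamma] `<=` OC Gamma.
Proof.
have fgG := module_fg.
move=> _ [A /OSP[]// oA [a a_gt0 [qA qAT]] <-].
(* In dimension zero the only matrix is the identity. *)
have [d0|d_gt0] := posnP d.
  have -> : A *m A = 1%:M by apply/matrixP => -[k kd]; exfalso; move: kd; rewrite d0.
  exact: OC1.
apply: (OC_of_scale_fraction _ (a ^+ 2)); first exact: exprn_gt0.
- exact: sqr_scale_fraction qA.
- by rewrite trmx_mul mulmxA -(mulmxA A) oA mulmx1.
- by rewrite expr2 -scalerA scalemxAr scalemxAl; apply: quasi_preservesM.
- rewrite trmx_mul expr2 invfM -scalerA scalemxAr scalemxAl.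
  exact: quasi_preservesM.
Qed.

(** Writing [d = 2 k + 1], the factor [a] is the quotient of [a ^ d] by
    [(a ^ 2) ^ k], two elements of [K]. *)
Lemma OS_odd : odd d -> OS Gamma = OC Gamma.
Proof.
move=> d_odd; have fgG := module_fg; apply/seteqP; split; last by move=> A; exact: OC_OS.
move=> A /OSP[]// oA [a a_gt0 [qA qAT]].
apply: (OC_of_scale_fraction _ a) => //.
have ad : a ^+ d = a * a ^+ 2 ^+ d./2.
  by rewrite -[in LHS](odd_double_half d) d_odd exprD expr1 -mul2n exprM.
have -> : a = a ^+ d * (a ^+ 2 ^+ d./2)^-1.
  by rewrite ad mulfK // !expf_neq0 // lt0r_neq0.
apply: fractionM; first exact: det_scale_fraction qA.
apply: fractionV; apply: fractionX; apply: sqr_scale_fraction qA => //.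
exact: odd_gt0.
Qed.

End ModuleOverK.

Theorem theorem3p19 (R : realType) (S : subringClosed R)
    (S_fg : fg_Zmodule [set x : R | x \in S])
    (d : nat) (Gamma : set 'cV[R]_d)
    (Gamma_over_K : Smodule_over S (fraction_field S) Gamma) :
  [set A *m A | A in OS Gamma] `<=` OC Gamma /\
  (~~ odd d ->
     elementary_abelian_2group (@coset_mul R d)
       (factor_group (OS Gamma) (OC Gamma))) /\
  (odd d -> OS Gamma = OC Gamma).
Proof.
have OS2 := OS_sqr R S S_fg d Gamma Gamma_over_K.
split=> //; split=> [_|]; last exact: OS_odd Gamma_over_K.
by apply: factor_group_elementary => //; apply: module_fg Gamma_over_K.
Qed.
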